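(* Let $(X_n)_{n\in\mathbf{Z}}$ be a Markov chain on a finite set $E$, governed by a measurable map $f:E\times G\to E$ and i.i.d. innovations $V=(V_n)_{n\in\mathbf{Z}}$, with irreducible and aperiodic kernel (see context). Let $$R_0=\bigcap_{n\in\mathbf{N}}T_n(E),\qquad T_n=f_{V_0}\circ f_{V_{-1}}\circ\cdots\circ f_{V_{-n+1}},\quad T_0=\mathrm{id}_E .$$ Then, almost surely, the conditional law of $X_0$ given $V$ is the uniform law on $R_0$.
   Context: Setting: $E$ is a finite set, $(G,\mathcal{G})$ a measurable space, $f:E\times G\to E$ measurable, $(V_n)_{n\in\mathbf{Z}}$ i.i.d. random variables with values in $G$ and common law $\beta$; for every $n\in\mathbf{Z}$, $X_{n+1}=f(X_n,V_{n+1})$ and $V_{n+1}$ is independent of $((X_k,V_k))_{k\le n}$. The kernel $\Pi$ of the chain, where $\Pi(x,\cdot)$ is the law of $f(x,V_1)$, is assumed irreducible and aperiodic. For $v\in G$, $f_v:E\to E$ is $f_v(x)=f(x,v)$. The images $T_n(E)$ form a decreasing sequence of finite nonempty sets, so $R_0$ is a nonempty random subset of $E$, equal to $T_n(E)$ for $n$ large enough. *)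

(* Defs.v *)
From HB Require Import structures.
From mathcomp Require Import all_boot all_order all_algebra.
From mathcomp Require Import finmap.
From mathcomp Require Import all_classical all_reals all_analysis.

Set Implicit Arguments.
Unset Strict Implicit.
Unset Printing Implicit Defensive.

Import Order.TTheory GRing.Theory Num.Theory.
Import numFieldNormedType.Exports.

Local Open Scope classical_set_scope.
Local Open Scope ring_scope.
Local Open Scope ereal_scope.

(* A finite state space, carrying the discrete sigma-algebra.  As every
   measurableType of the library, it is pointed, hence nonempty. *)
HB.mixin Record isDiscreteMeasurable d T of Measurable d T := {
  discrete_measurableP : forall A : set T, measurable A
}.

#[short(type="finDiscreteMeasurableType")]
HB.structure Definition FinDiscreteMeasurable d :=
  {T of Finite T & Measurable d T & isDiscreteMeasurable d T}.

Section independence.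
Context {d : measure_display} {Omega : measurableType d} {R : realType}.
Variable P : probability Omega R.

(* A set system generating the sigma-algebra sigma(Y i : i in D). *)
Definition family_preimages (I : Type) {d'} {T : measurableType d'}
    (D : set I) (Y : I -> Omega -> T) : set (set Omega) :=
  \bigcup_(i in D) preimage_set_system setT (Y i) measurable.

Definition mutually_independent (I : choiceType) {d'} {T : measurableType d'}
    (Y : I -> {RV P >-> T}) : Prop :=
  forall (J : {fset I}) (A : I -> set T), (forall i, measurable (A i)) ->
    P (\bigcap_(i in [set` J]) Y i @^-1` A i) =
    \prod_(i <- J) P (Y i @^-1` A i).

Definition iid (I : choiceType) {d'} {T : measurableType d'}
    (beta : probability T R) (Y : I -> {RV P >-> T}) : Prop :=
  mutually_independent Y /\
  forall i A, measurable A -> distribution P (Y i) A = beta A.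

Definition independent_of_family (I : Type) {d1 d2} {T1 : measurableType d1}
    {T2 : measurableType d2} (U : Omega -> T1) (D : set I)
    (Y : I -> Omega -> T2) : Prop :=
  forall A B, measurable A -> <<s family_preimages D Y >> B ->
    P (U @^-1` A `&` B) = P (U @^-1` A) * P B.

(* mu is a (regular) conditional law of Y given the sigma-algebra generated by
   F: being a kernel from g_sigma_algebraType F, each map w |-> mu w A is
   <<s F >>-measurable. *)
Definition is_conditional_law {d'} {T : measurableType d'} (Y : {RV P >-> T})
    (F : set (set Omega)) (mu : R.-pker (g_sigma_algebraType F) ~> T) : Prop :=
  forall A B, measurable A -> <<s F >> B ->
    \int[P]_(w in B) mu w A = P (B `&` Y @^-1` A).

End independence.

Section finite_chains.
Context {R : realType} {E : finType}.
Implicit Type K : E -> E -> R.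

Fixpoint kernel_pow K (n : nat) (x y : E) : R :=
  if n is m.+1 then (\sum_(z : E) K x z * kernel_pow K m z y)%R
  else (x == y)%:R%R.

Definition irreducible_kernel K : Prop :=
  forall x y, exists n, (0 < kernel_pow K n x y)%R.

(* For every x, the gcd of the possible return times to x is 1. *)
Definition aperiodic_kernel K : Prop :=
  forall (x : E) (p : nat),
    (forall n, (0 < n)%N -> (0 < kernel_pow K n x x)%R -> (p %| n)%N) ->
    p = 1%N.

Definition uniform_law (S A : set E) : \bar R :=
  (#|S `&` A|%:R / #|S|%:R)%:E.

End finite_chains.

Section random_maps.
Context {d dE dG : measure_display} {Omega : measurableType d} {R : realType}.
Context {P : probability Omega R}.
Context {E : finDiscreteMeasurableType dE} {G : measurableType dG}.
Variables (f : {mfun (E * G)%type >-> E}) (V : int -> {RV P >-> G}).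

(* Pi(x, {y}), where Pi(x, .) is the law of f(x, V_1). *)
Definition transition (x y : E) : R :=
  fine (pushforward P (fun w => f (x, V 1%R w)) [set y]).

(* T_n = f_{V_0} o f_{V_{-1}} o ... o f_{V_{-n+1}} *)
Fixpoint backward_map (n : nat) (w : Omega) (x : E) : E :=
  if n is m.+1 then backward_map m w (f (x, V (- m%:Z)%R w)) else x.

Definition limit_image (w : Omega) : set E :=
  \bigcap_n (backward_map n w @` [set: E]).

End random_maps.

(* Main.v *)
From HB Require Import structures.
Require Import Defs.
From mathcomp Require Import all_boot all_order all_algebra.
From mathcomp Require Import finmap.
From mathcomp Require Import all_classical all_reals all_analysis.
From mathcomp Require Import measurable_realfun.
From mathcomp Require Import zify ring lra.

(** Each value v of an innovation acts on E through the map x |-> f (x, v), so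
    T_n is a composition of n independent random self-maps of E.  Call a map
    reachable if some T_n takes it with positive probability, and minimal if it
    is reachable and its image has the least cardinality among reachable maps.

    The law pi of X_n does not depend on n: for an irreducible aperiodic kernel
    the powers contract signed measures of total mass zero
    (kernel_pow_all_gt0), so that two sequences of laws indexed by the past
    which are propagated by the kernel coincide (backward_orbit_unique).

    The core of the argument is minimal_fiber_mass: if T is minimal, the image of
    pi by T is the uniform law on T(E).  It rests on a maximum principle.  Let M
    be the largest mass pi(T^-1 x), over minimal T and points x, attained by S
    and x.  As pi is stationary, M is an average of the masses
    pi((S o g)^-1 x) over reachable g, each at most M, so all of them equal M.  Given a point r,
    irreducibility provides a reachable g such that (S o g) sends S(r) to x;
    since S o g is injective on S(E), the set (S o g o S)^-1 x is the fiber of S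
    through r.  Hence every fiber of S has mass M, and M is the inverse of the
    minimal rank.  For any other minimal T, the masses of the fibers are at most
    M and add up to 1, so they all equal M.

    Since X_0 = T_n(X_(-n)), where X_(-n) has law pi and is independent of the
    innovations of index > -n, on the event that T_n is minimal the conditional
    law of X_0 given these innovations is uniform on T_n(E)
    (pr_state_backward, minimal_weight).  On that event T_n(E) = R_0 almost
    surely, because later images cannot be smaller (pr_limit_set_minimal).  As
    the probability that T_n is not minimal tends to 0 (nonminimal_decay), the
    conditional probability formula holds exactly on all cylinder events, hence
    on sigma(V) (limit_set_conditional_law).  Existence follows since w |->
    uniform law on R_0(w) is a probability kernel, and uniqueness up to a null
    event since two sigma(V)-measurable functions with the same integrals over
    sigma(V) agree almost surely. *)

Set Implicit Arguments.
Unset Strict Implicit.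
Unset Printing Implicit Defensive.

Import Order.TTheory GRing.Theory Num.Theory.
Import numFieldNormedType.Exports.

Local Open Scope classical_set_scope.
Local Open Scope ring_scope.

(** * Aperiodic chains on a finite set *)

(** An additive submonoid of nat whose positive elements have gcd 1 contains every
    large enough integer. *)
Lemma numerical_semigroup (A : nat -> Prop) :
  A 0%N -> (forall a b, A a -> A b -> A (a + b)%N) ->
  (forall p, (forall n, (0 < n)%N -> A n -> (p %| n)%N) -> p = 1%N) ->
  exists n0, forall n, (n0 <= n)%N -> A n.
Proof.
move=> A0 AD Agcd.
have AM k a : A a -> A (k * a)%N.
  by move=> Aa; elim: k => [|k IH]; rewrite ?mul0n// mulSn; exact: AD.
(* The least positive difference of two elements of A divides every element
   of A, hence is 1: A contains two consecutive integers b and b + 1. *)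
pose D p := (0 < p)%N /\ exists b, A b /\ A (b + p)%N.
have exD : exists p, `[< D p >].
  apply: contrapT => noD.
  suff : (2 = 1)%N by [].
  apply: Agcd => n n0 An; exfalso; apply: noD; exists n; apply/asboolP.
  by split => //; exists 0%N.
case: (ex_minnP exD) => p /asboolP[p0 [b [Ab Abp]]] pmin.
have p1 : p = 1%N.
  apply: Agcd => n n0 An; rewrite /dvdn; apply: contraT; rewrite -lt0n => r0.
  suff /pmin : `[< D (n %% p)%N >] by rewrite leqNgt ltn_mod p0.
  apply/asboolP; split => //; exists ((n %/ p) * (b + p))%N; split; first exact: AM.
  suff -> : ((n %/ p) * (b + p) + n %% p = (n %/ p) * b + n)%N.
    by apply: AD => //; exact: AM.
  by rewrite mulnDr -addnA -divn_eq.
subst p; have [b0|b0] := posnP b.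
  exists 0%N => n _; rewrite -(muln1 n); apply: AM; by rewrite b0 in Abp.
exists (b * b)%N => n bn.
(* n = q b + r with r < b <= q is a sum of r copies of b + 1 and q - r
   copies of b. *)
have rq : (n %% b <= n %/ b)%N.
  by rewrite (leq_trans (ltnW (ltn_pmod n b0)))// leq_divRL.
have -> : (n = (n %% b) * (b + 1) + (n %/ b - n %% b) * b)%N.
  by rewrite {1}(divn_eq n b) mulnBl; nia.
by apply: AD; exact: AM.
Qed.

Lemma geometric_le0 (R : realType) (c a s : R) :
  0 <= c < 1 -> (forall j, s <= a * c ^+ j) -> s <= 0.
Proof.
move=> /andP[c0 c1] sc.
have : (fun j => a * c ^+ j) @ \oo --> (0 : R).
  rewrite -[X in _ --> X](mulr0 a); apply: cvgM; first exact: cvg_cst.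
  by apply: cvg_expr; rewrite ger0_norm.
move=> h; rewrite -(cvg_lim _ h)//; apply: limr_ge; first by apply/cvg_ex; exists 0.
exact: nearW.
Qed.

Section finite_kernels.
Variables (R : realType) (E : finType) (K : E -> E -> R).
Hypothesis K_ge0 : forall x y, 0 <= K x y.
Hypothesis K_sum1 : forall x, \sum_y K x y = 1.

Lemma kernel_pow_ge0 n x y : 0 <= kernel_pow K n x y.
Proof.
by elim: n x => [|n IH] x /=; [exact: ler0n|apply: sumr_ge0 => z _; exact: mulr_ge0].
Qed.

Lemma kernel_pow_sum1 n x : \sum_y kernel_pow K n x y = 1.
Proof.
elim: n x => [|n IH] x /=.
  by rewrite (bigD1 x)//= eqxx big1 ?addr0// => y; rewrite eq_sym => /negbTE->.
rewrite exchange_big/= -(K_sum1 x); apply: eq_bigr => z _.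
by rewrite -mulr_sumr IH mulr1.
Qed.

Lemma kernel_powD m n x y :
  kernel_pow K (m + n) x y = \sum_z kernel_pow K m x z * kernel_pow K n z y.
Proof.
elim: m x => [|m IH] x /=.
  rewrite add0n (bigD1 x)//= eqxx mul1r big1 ?addr0// => z zx.
  by rewrite eq_sym (negbTE zx) mul0r.
under [LHS]eq_bigr do rewrite IH mulr_sumr.
under [RHS]eq_bigr do rewrite mulr_suml.
by rewrite exchange_big/=; apply: eq_bigr => z _; apply: eq_bigr => t _; rewrite mulrA.
Qed.

Lemma kernel_powD_gt0 m n x z y :
  0 < kernel_pow K m x z -> 0 < kernel_pow K n z y ->
  0 < kernel_pow K (m + n) x y.
Proof.
move=> mxz nzy; rewrite kernel_powD (bigD1 z)//= ltr_pwDl ?mulr_gt0//.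
by apply: sumr_ge0 => t _; rewrite mulr_ge0// kernel_pow_ge0.
Qed.

Lemma kernel_pow_all_gt0 : irreducible_kernel K -> aperiodic_kernel K ->
  exists N, forall x y, 0 < kernel_pow K N x y.
Proof.
move=> irr aper.
have ret x : exists n0, forall n, (n0 <= n)%N -> 0 < kernel_pow K n x x.
  apply: numerical_semigroup => [|a b|p]; first by rewrite /= eqxx.
    exact: kernel_powD_gt0.
  exact: aper.
have [r rP] := choice ret.
have /choice[l lP] (u : E * E) : exists n, 0 < kernel_pow K n u.1 u.2 by exact: irr.
exists ((\max_x r x) + \max_u l u)%N => x y.
have -> : ((\max_x r x) + \max_u l u =
    ((\max_x r x) + ((\max_u l u) - l (x, y))) + l (x, y))%N.
  by rewrite -addnA subnK// leq_bigmax.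
apply: kernel_powD_gt0 (lP (x, y)); apply: rP.
by rewrite (leq_trans _ (leq_addr _ _))// leq_bigmax.
Qed.

Lemma backward_orbit_pow (u : nat -> E -> R) :
  (forall n y, u n y = \sum_x u n.+1 x * K x y) ->
  forall m n y, u n y = \sum_x u (n + m)%N x * kernel_pow K m x y.
Proof.
move=> uK; elim=> [|m IH] n y /=.
  rewrite addn0 (bigD1 y)//= eqxx mulr1 big1 ?addr0// => z zy.
  by rewrite (negbTE zy) mulr0.
rewrite IH; under [LHS]eq_bigr do rewrite uK mulr_suml.
under [RHS]eq_bigr do rewrite mulr_sumr.
rewrite exchange_big/=; apply: eq_bigr => x _; apply: eq_bigr => z _.
by rewrite addnS mulrA.
Qed.

(** Two sequences of laws, indexed by the distance to the present and propagated
    by an irreducible aperiodic kernel, have the same present value.  With N such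
    that K^N > 0, the l1 norm of their difference is contracted by a factor c < 1
    every N steps, while it is at most 2. *)
Lemma backward_orbit_unique (u v : nat -> E -> R) :
  irreducible_kernel K -> aperiodic_kernel K ->
  (forall n y, u n y = \sum_x u n.+1 x * K x y) ->
  (forall n y, v n y = \sum_x v n.+1 x * K x y) ->
  (forall n x, 0 <= u n x) -> (forall n, \sum_x u n x = 1) ->
  (forall n x, 0 <= v n x) -> (forall n, \sum_x v n x = 1) ->
  u 0%N =1 v 0%N.
Proof.
move=> irr aper uK vK u0 u1 v0 v1.
have [N KN] := kernel_pow_all_gt0 irr aper.
pose d n x := u n x - v n x.
have dK : forall n y, d n y = \sum_x d n.+1 x * K x y.
  move=> n y; rewrite /d uK vK -sumrB; apply: eq_bigr => x _; by rewrite mulrBl.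
have dsum n : \sum_x d n x = 0 by rewrite sumrB u1 v1 subrr.
move=> x0.
pose w0 : E * E := (x0, x0).
pose w := [arg min_(w < w0) kernel_pow K N w.1 w.2]%O.
pose delta := kernel_pow K N w.1 w.2.
have delta_gt0 : 0 < delta by exact: KN.
have delta_le x y : delta <= kernel_pow K N x y.
  rewrite /delta /w; case: arg_minP => //= i _ /(_ (x, y)); exact.
pose c := 1 - #|E|%:R * delta.
have cE x : \sum_y (kernel_pow K N x y - delta) = c.
  by rewrite sumrB kernel_pow_sum1 sumr_const -mulr_natl.
have c01 : 0 <= c < 1.
  apply/andP; split.
    by rewrite -(cE x0); apply: sumr_ge0 => y _; rewrite subr_ge0.
  rewrite /c ltrBlDr ltrDl mulr_gt0// ltr0n; apply/card_gt0P; by exists x0.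
pose S n := \sum_x `|d n x|.
have S2 n : S n <= 2.
  rewrite (_ : 2 = \sum_x (u n x + v n x)); last first.
    rewrite big_split/= u1 v1; ring.
  apply: ler_sum => x _; rewrite /d (le_trans (ler_normB _ _))//.
  by rewrite !ger0_norm.
(* Subtracting the constant delta from K^N is free, as d has total mass zero. *)
have Sc n : S n <= c * S (n + N)%N.
  have -> : S n = \sum_y `|\sum_x d (n + N)%N x * (kernel_pow K N x y - delta)|.
    apply: eq_bigr => y _; congr `|_|.
    under eq_bigr do rewrite mulrBr.
    by rewrite sumrB -mulr_suml dsum mul0r subr0; exact: backward_orbit_pow.
  apply: (@le_trans _ _ (\sum_y \sum_x `|d (n + N)%N x| * (kernel_pow K N x y - delta))).
    apply: ler_sum => y _; rewrite (le_trans (ler_norm_sum _ _ _))//.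
    apply: ler_sum => x _; by rewrite normrM (@ger0_norm _ (_ - delta)) ?subr_ge0.
  rewrite exchange_big/= mulr_sumr; apply: ler_sum => x _.
  by rewrite -mulr_sumr cE mulrC.
have Sj j : S 0%N <= 2 * c ^+ j.
  have /andP[c0 _] := c01.
  suff h : S 0%N <= c ^+ j * S (j * N)%N.
    by rewrite (le_trans h)// mulrC ler_wpM2r// exprn_ge0.
  elim: j => [|j IH]; first by rewrite mul0n expr0 mul1r.
  rewrite (le_trans IH)// exprSr -mulrA ler_wpM2l ?exprn_ge0//.
  by rewrite mulSn addnC; exact: Sc.
have S0 : S 0%N <= 0 by apply: geometric_le0 c01 Sj.
apply/eqP; rewrite -subr_eq0 -normr_le0 (le_trans _ S0)//.
by rewrite /S (bigD1 x0)//= lerDl sumr_ge0.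
Qed.

End finite_kernels.

(** * Random compositions of self-maps *)

Section self_maps.
Variable E : finType.
Implicit Types (T g h : {ffun E -> E}) (x y : E).

Definition map_id : {ffun E -> E} := [ffun x => x].

(** The composition T o g: g is applied first. *)
Definition map_comp T g : {ffun E -> E} := [ffun x => T (g x)].

(** The number of values of a self-map. *)
Definition map_rank T : nat := #|T @: E|.

Lemma map_comp1r T : map_comp T map_id = T.
Proof. by apply/ffunP => x; rewrite !ffunE. Qed.

Lemma map_compA T g h : map_comp T (map_comp g h) = map_comp (map_comp T g) h.
Proof. by apply/ffunP => x; rewrite !ffunE. Qed.

Lemma map_comp_image T g : map_comp T g @: E = T @: (g @: E).
Proof. by rewrite -imset_comp; apply: eq_imset => x; rewrite ffunE. Qed.

Lemma map_rank_compl T g : (map_rank (map_comp T g) <= map_rank T)%N.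
Proof.
by rewrite /map_rank map_comp_image subset_leq_card// imsetS//; exact: subset_predT.
Qed.

Lemma map_rank_compr T g : (map_rank (map_comp T g) <= map_rank g)%N.
Proof. by rewrite /map_rank map_comp_image leq_imset_card. Qed.

End self_maps.

Section random_self_maps.
Variables (R : realType) (E : finType) (q : {ffun E -> E} -> R).
Hypothesis q_ge0 : forall g, 0 <= q g.
Hypothesis q_sum1 : \sum_g q g = 1.
Implicit Types (T g h : {ffun E -> E}) (x y : E) (phi : {ffun E -> E} -> R).

(** The law of the composition of n independent maps of law q; each new map is
    composed on the right, that is, applied before the previous ones. *)
Fixpoint comp_law (n : nat) T : R :=
  if n is m.+1 then \sum_T' comp_law m T' * \sum_g q g * (map_comp T' g == T)%:R
  else (T == map_id E)%:R.

(** The transition kernel of the chain driven by maps of law q. *)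
Definition map_kernel x y : R := \sum_g q g * (g x == y)%:R.

(** T is a value of some finite composition of maps of law q. *)
Definition reachable T : Prop := exists n, 0 < comp_law n T.

Lemma sum_indicator (I : finType) (i0 : I) (F : I -> R) :
  \sum_i (i0 == i)%:R * F i = F i0.
Proof.
rewrite (bigD1 i0)//= eqxx mul1r big1 ?addr0// => i ii0.
by rewrite eq_sym (negbTE ii0) mul0r.
Qed.

Lemma comp_law_ge0 n T : 0 <= comp_law n T.
Proof.
elim: n T => [|n IH] T /=; first exact: ler0n.
apply: sumr_ge0 => T' _; rewrite mulr_ge0// sumr_ge0// => g _.
by rewrite mulr_ge0.
Qed.

Lemma comp_law0_expect phi : \sum_T comp_law 0 T * phi T = phi (map_id E).
Proof. by rewrite -[RHS]sum_indicator; apply: eq_bigr => T _; rewrite /= eq_sym. Qed.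

Lemma comp_lawS_expect n phi :
  \sum_T comp_law n.+1 T * phi T =
  \sum_T comp_law n T * \sum_g q g * phi (map_comp T g).
Proof.
rewrite /=; under eq_bigr do rewrite mulr_suml.
rewrite exchange_big/=; apply: eq_bigr => T' _.
under eq_bigr do rewrite -mulrA mulr_suml.
rewrite -mulr_sumr exchange_big/=; congr (_ * _); apply: eq_bigr => g _.
under eq_bigr do rewrite -mulrA.
by rewrite -mulr_sumr sum_indicator.
Qed.

Lemma comp_lawD_expect n m phi :
  \sum_T comp_law (n + m) T * phi T =
  \sum_T comp_law n T * \sum_g comp_law m g * phi (map_comp T g).
Proof.
elim: m phi => [|m IH] phi.
  rewrite addn0; apply: eq_bigr => T _; congr (_ * _).
  by rewrite (comp_law0_expect (fun g => phi (map_comp T g))) map_comp1r.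
rewrite addnS comp_lawS_expect IH; apply: eq_bigr => T _; congr (_ * _).
rewrite comp_lawS_expect; apply: eq_bigr => g _; congr (_ * _).
by apply: eq_bigr => h _; rewrite map_compA.
Qed.

Lemma comp_law_sum1 n : \sum_T comp_law n T = 1.
Proof.
elim: n => [|n IH].
  by have := comp_law0_expect (fun=> 1); under eq_bigr do rewrite mulr1.
have := comp_lawS_expect n (fun=> 1); under eq_bigr do rewrite mulr1.
move=> ->; rewrite -[RHS]IH; apply: eq_bigr => T _.
by under eq_bigr do rewrite mulr1; rewrite q_sum1 mulr1.
Qed.

Lemma map_kernel_ge0 x y : 0 <= map_kernel x y.
Proof. by apply: sumr_ge0 => g _; rewrite mulr_ge0. Qed.

Lemma map_kernel_sum1 x : \sum_y map_kernel x y = 1.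
Proof.
rewrite exchange_big/= -[RHS]q_sum1; apply: eq_bigr => g _.
rewrite -mulr_sumr -[RHS]mulr1; congr (_ * _).
by rewrite -[RHS](sum_indicator (g x) (fun=> 1)); apply: eq_bigr => y _; rewrite mulr1.
Qed.

Lemma map_kernel_pow n x y :
  kernel_pow map_kernel n x y = \sum_T comp_law n T * (T x == y)%:R.
Proof.
elim: n x => [|n IH] x.
  by rewrite (comp_law0_expect (fun T => (T x == y)%:R)) ffunE.
rewrite (comp_lawS_expect n (fun T => (T x == y)%:R)) /=.
under eq_bigr do rewrite IH mulr_suml.
rewrite exchange_big/=.
under [RHS]eq_bigr do rewrite mulr_sumr.
rewrite [RHS]exchange_big/=; apply: eq_bigr => g _.
under eq_bigr do rewrite -mulrA.
rewrite -mulr_sumr sum_indicator mulr_sumr; apply: eq_bigr => T _.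
by rewrite ffunE mulrCA.
Qed.

Lemma reachable_comp T g : reachable T -> reachable g -> reachable (map_comp T g).
Proof.
move=> [n nT] [m mg]; exists (n + m)%N; set U := map_comp T g.
have := comp_lawD_expect n m (fun S => (U == S)%:R).
under eq_bigr do rewrite mulrC.
rewrite sum_indicator => ->.
have h S : 0 <= \sum_g0 comp_law m g0 * (U == map_comp S g0)%:R.
  by apply: sumr_ge0 => h _; rewrite mulr_ge0// comp_law_ge0.
rewrite (bigD1 T)//= ltr_pwDl//; last first.
  by apply: sumr_ge0 => S _; rewrite mulr_ge0// comp_law_ge0.
rewrite mulr_gt0// (bigD1 g)//= ltr_pwDl//; first by rewrite eqxx mulr1.
by apply: sumr_ge0 => S _; rewrite mulr_ge0// comp_law_ge0.
Qed.

Lemma reachable_irreducible : irreducible_kernel map_kernel ->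
  forall x y, exists2 g, reachable g & g x = y.
Proof.
move=> irr x y; have [n] := irr x y.
rewrite map_kernel_pow => h.
apply: contrapT => H; move: h; rewrite big1 ?ltxx// => T _.
have [Txy|] := eqVneq (T x) y; last by rewrite mulr0.
rewrite mulr1; apply/eqP; rewrite eq_le comp_law_ge0 andbT leNgt.
by apply/negP => T0; apply: H; exists T => //; exists n.
Qed.

Section stationary.
Variable pi : E -> R.
Hypothesis pi_sum1 : \sum_x pi x = 1.
Hypothesis pi_stat : forall y, pi y = \sum_x pi x * map_kernel x y.
Hypothesis irr : irreducible_kernel map_kernel.

(** The mass of the fiber of T over x for the stationary law pi. *)
Definition fiber_mass T x : R := \sum_(e | T e == x) pi e.

Lemma fiber_massE T x : fiber_mass T x = \sum_e pi e * (T e == x)%:R.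
Proof.
by rewrite /fiber_mass big_mkcond; apply: eq_bigr => e _; case: eqP => _;
  rewrite ?mulr1 ?mulr0.
Qed.

(** By stationarity of pi, the fiber masses form a harmonic function of T for the
    composition on the right by a random map. *)
Lemma fiber_mass_harmonic n T x :
  \sum_g comp_law n g * fiber_mass (map_comp T g) x = fiber_mass T x.
Proof.
have pin y : pi y = \sum_e pi e * kernel_pow map_kernel n e y.
  exact: (@backward_orbit_pow _ _ _ (fun=> pi)).
under eq_bigr do rewrite fiber_massE mulr_sumr.
rewrite exchange_big/= fiber_massE.
under [RHS]eq_bigr do rewrite pin mulr_suml.
rewrite [RHS]exchange_big/=; apply: eq_bigr => e _.
under [RHS]eq_bigr do rewrite map_kernel_pow -mulrA mulr_suml.
rewrite -mulr_sumr exchange_big/= mulr_sumr; apply: eq_bigr => g _.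
under eq_bigr do rewrite -mulrA.
by rewrite -mulr_sumr sum_indicator ffunE mulrCA.
Qed.

Lemma fiber_mass_sum1 T : \sum_(x in T @: E) fiber_mass T x = 1.
Proof.
rewrite -pi_sum1 [RHS](partition_big T (mem (T @: E)))/=; last first.
  by move=> e _; exact: imset_f.
by apply: eq_big => // x _; apply: eq_bigl => e.
Qed.

(** Reachable maps of least rank. *)
Definition minimal T :=
  reachable T /\ forall g, reachable g -> (map_rank T <= map_rank g)%N.

Lemma minimal_exists : exists T, minimal T.
Proof.
have ex : exists k, `[< exists T, reachable T /\ map_rank T = k >].
  exists (map_rank (map_id E)); apply/asboolP; exists (map_id E); split => //.
  by exists 0%N; rewrite /= eqxx.
case: (ex_minnP ex) => k /asboolP[T [rT Tk]] kmin.
exists T; split=> // g rg; rewrite Tk; apply: kmin; apply/asboolP; by exists g.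
Qed.

Lemma minimal_compr T g : minimal T -> reachable g -> minimal (map_comp T g).
Proof.
move=> [rT Tmin] rg; split; first exact: reachable_comp.
by move=> h rh; rewrite (leq_trans (map_rank_compl _ _))// Tmin.
Qed.

Lemma minimal_compl T g : minimal T -> reachable g -> minimal (map_comp g T).
Proof.
move=> [rT Tmin] rg; split; first exact: reachable_comp.
by move=> h rh; rewrite (leq_trans (map_rank_compr _ _))// Tmin.
Qed.

Lemma minimal_rank T g : minimal T -> minimal g -> map_rank T = map_rank g.
Proof. by move=> [rT Tm] [rg gm]; apply/eqP; rewrite eqn_leq Tm// gm. Qed.

(** Any reachable g is injective on the image of a minimal T, since composing by g
    cannot lower the rank. *)
Lemma minimal_same_fibers T g : minimal T -> reachable g ->
  forall e e', (map_comp g T e == map_comp g T e') = (T e == T e').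
Proof.
move=> mT rg e e'; rewrite !ffunE.
have /imset_injP inj : #|g @: (T @: E)| == #|T @: E|.
  by rewrite -map_comp_image -2!/(map_rank _) (minimal_rank mT (minimal_compl mT rg)).
by apply/eqP/eqP => [|->//]; apply: inj; exact: imset_f.
Qed.

(** The image of the stationary law by a minimal map is uniform on its image. *)
Lemma minimal_fiber_mass T x : minimal T -> x \in T @: E ->
  fiber_mass T x = (map_rank T)%:R^-1.
Proof.
move=> mT xT.
pose good (u : {ffun E -> E} * E) := `[< minimal u.1 >].
have good0 : good (T, x) by apply/asboolP.
pose u := [arg max_(u > (T, x) | good u) fiber_mass u.1 u.2]%O.
pose M := fiber_mass u.1 u.2.
have [mu1 Mmax] : minimal u.1 /\ forall T' x', minimal T' -> fiber_mass T' x' <= M.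
  rewrite /M /u; case: arg_maxP => // i /asboolP mi imax; split => // T' x' mT'.
  by apply: (imax (T', x')); apply/asboolP.
(* Maximum principle: the average M of values at most M has only values M. *)
have Minv g : reachable g -> fiber_mass (map_comp u.1 g) u.2 = M.
  move=> [n ng].
  have gapE : \sum_h comp_law n h * (M - fiber_mass (map_comp u.1 h) u.2) = 0.
    under eq_bigr do rewrite mulrBr.
    by rewrite sumrB -mulr_suml comp_law_sum1 mul1r fiber_mass_harmonic subrr.
  have gap_ge0 h : 0 <= comp_law n h * (M - fiber_mass (map_comp u.1 h) u.2).
    have [->|h0] := eqVneq (comp_law n h) 0; first by rewrite mul0r.
    rewrite mulr_ge0 ?comp_law_ge0// subr_ge0; apply/Mmax/minimal_compr => //.
    by exists n; rewrite lt_def h0 comp_law_ge0.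
  move/psumr_eq0P : gapE => /(_ (fun h _ => gap_ge0 h) g isT)/eqP.
  by rewrite mulf_eq0 (gt_eqF ng)/= subr_eq0 => /eqP.
have M0 : M != 0.
  apply/eqP => M0; have := fiber_mass_sum1 T; apply/eqP; rewrite lt_eqF//.
  apply: le_lt_trans ltr01; apply: sumr_le0 => y _; rewrite -M0; exact: Mmax.
(* The fiber through r is the preimage of u.2 by u.1 o g o u.1, where g sends
   u.1 r to some e in the fiber of u.1 over u.2. *)
have Mfib r : fiber_mass u.1 (u.1 r) = M.
  have [e ue] : exists e, u.1 e = u.2.
    apply: contrapT => ne; move/negP: M0; apply; apply/eqP.
    apply: big1 => e /eqP ue; exfalso; apply: ne; by exists e.
  have [g rg ge] := reachable_irreducible irr (u.1 r) e.
  rewrite -(Minv (map_comp g u.1)); last exact: reachable_comp (proj1 mu1).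
  rewrite /fiber_mass; apply: eq_bigl => e'.
  have -> : u.2 = map_comp u.1 (map_comp g u.1) r by rewrite !ffunE ge.
  by rewrite map_compA minimal_same_fibers//; exact: reachable_comp (proj1 mu1) _.
have kM : (map_rank T)%:R * M = 1.
  rewrite -[RHS](fiber_mass_sum1 u.1) [RHS](eq_bigr (fun=> M)).
    by rewrite sumr_const (minimal_rank mT mu1) mulr_natl.
  by move=> y /imsetP[r _ ->].
(* The fiber masses of T are at most M and have the same sum as if they were
   all equal to M. *)
have gapE : \sum_(y in T @: E) (M - fiber_mass T y) = 0.
  by rewrite sumrB fiber_mass_sum1 sumr_const -mulr_natl -/(map_rank T) kM subrr.
have gap_ge0 y : 0 <= M - fiber_mass T y by rewrite subr_ge0; exact: Mmax.
move/psumr_eq0P : gapE => /(_ (fun y _ => gap_ge0 y) x xT)/eqP.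
rewrite subr_eq0 => /eqP <-; apply/(mulfI (x := (map_rank T)%:R)).
  by apply: contra_eq_neq kM => ->; rewrite mul0r eq_sym oner_eq0.
rewrite kM divff//; apply: contra_eq_neq kM => ->; by rewrite mul0r eq_sym oner_eq0.
Qed.

End stationary.

(** A minimal g0 is a composition of m maps with positive probability, and composing
    with g0 makes any reachable map minimal: every m steps, the probability of not
    being minimal is multiplied by at most 1 - P(g0). *)
Lemma nonminimal_decay : exists c m, 0 <= c < 1 /\
  (forall n j, \sum_(T | ~~ `[< minimal T >]) comp_law (n + j * m) T <= c ^+ j).
Proof.
have [g0 [[m mg0] g0min]] := minimal_exists.
have mg0' : minimal g0 by split => //; exists m.
pose b n := \sum_(T | ~~ `[< minimal T >]) comp_law n T.
pose phi T : R := (~~ `[< minimal T >])%:R.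
have bE n : b n = \sum_T comp_law n T * phi T.
  rewrite /b big_mkcond; apply: eq_bigr => T _; rewrite /phi; case: ifP => _;
    by rewrite ?mulr1 ?mulr0.
pose c := 1 - comp_law m g0.
have cE : c = \sum_(g | g != g0) comp_law m g.
  by rewrite /c -(comp_law_sum1 m) (bigD1 g0)//= addrAC subrr add0r.
have bc n : b (n + m)%N <= c * b n.
  rewrite !bE comp_lawD_expect mulr_sumr; apply: ler_sum => T _.
  have [->|nT] := eqVneq (comp_law n T) 0; first by rewrite !mul0r mulr0.
  rewrite mulrCA; apply: ler_wpM2l; first exact: comp_law_ge0.
  have rT : reachable T by exists n; rewrite lt_def nT comp_law_ge0.
  rewrite cE mulr_suml (bigD1 g0)//= {1}/phi.
  rewrite (_ : `[< minimal (map_comp T g0) >] = true)/=; last first.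
    by apply/asboolP; exact: minimal_compl.
  rewrite mulr0 add0r; apply: ler_sum => g _.
  have [->|mg] := eqVneq (comp_law m g) 0; first by rewrite !mul0r.
  apply: ler_wpM2l; first exact: comp_law_ge0.
  rewrite /phi; have [/asboolP mT|_] /= := boolP `[< minimal T >].
    rewrite (_ : `[< _ >] = true)//; apply/asboolP/minimal_compr => //.
    by exists m; rewrite lt_def mg comp_law_ge0.
  by rewrite lern1 leq_b1.
have c01 : 0 <= c < 1.
  apply/andP; split; last by rewrite /c ltrBlDr ltrDl.
  by rewrite cE sumr_ge0// => g _; exact: comp_law_ge0.
have b_le1 n : b n <= 1.
  rewrite -(comp_law_sum1 n) (bigID (fun T => ~~ `[< minimal T >]))/= lerDl.
  by rewrite sumr_ge0// => T _; exact: comp_law_ge0.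
exists c, m; split => // n; elim=> [|j IH]; first by rewrite addn0 expr0; exact: b_le1.
rewrite mulSn addnCA addnC -/(b _) (le_trans (bc _))// exprS.
by case/andP: c01 => c0 _; exact: ler_wpM2l.
Qed.

End random_self_maps.

(** * Events with real probabilities and finite-valued functions *)

Section real_probability.
Context {d : measure_display} {Omega : measurableType d} {R : realType}.
Variable P : probability Omega R.
Implicit Types A B : set Omega.

(** The probability of an event as a real number; it is meaningful on measurable
    events, where P is finite. *)
Definition pr B : R := fine (P B).

Lemma prE B : measurable B -> P B = (pr B)%:E.
Proof. by move=> mB; rewrite fineK// fin_num_measure. Qed.

Lemma pr_ge0 B : 0 <= pr B.
Proof. exact: fine_ge0. Qed.

Lemma pr_le A B : measurable A -> measurable B -> A `<=` B -> pr A <= pr B.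
Proof.
by move=> mA mB AB; rewrite -lee_fin -!prE// le_measure ?inE.
Qed.

Lemma pr_setT : pr setT = 1.
Proof. by rewrite /pr probability_setT. Qed.

Lemma pr_set0 : pr set0 = 0.
Proof. by rewrite /pr measure0. Qed.

Lemma pr_setD_null A B : measurable A -> measurable B -> pr B = 0 ->
  pr A <= pr (A `\` B).
Proof.
move=> mA mB B0; rewrite -lee_fin -!prE//; last exact: measurableD.
have AB0 : pr (A `&` B) = 0.
  apply/le_anti; rewrite pr_ge0 andbT -[leRHS]B0.
  by apply: pr_le => //; exact: measurableI.
have PAB0 : P (A `&` B) = 0%E by rewrite prE ?AB0//; exact: measurableI.
by rewrite (measureDI P mA mB) [X in (_ + X <= _)%E]PAB0 adde0.
Qed.

Lemma measurable_fin_preimage (I : finType) (h : Omega -> I) (D : set I) :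
  (forall i, measurable (h @^-1` [set i])) -> measurable (h @^-1` D).
Proof.
move=> mh; have -> : h @^-1` D = \bigcup_(i in D) h @^-1` [set i].
  by apply/seteqP; split => [w Dw|w [i Di /= hwi]]; [exists (h w)|rewrite /= hwi].
by apply: fin_bigcup_measurable.
Qed.

Lemma pr_partition (I : finType) (h : Omega -> I) B :
  (forall i, measurable (h @^-1` [set i])) -> measurable B ->
  pr B = \sum_i pr (B `&` h @^-1` [set i]).
Proof.
move=> mh mB; apply: EFin_inj; rewrite -prE// -sumEFin.
rewrite [RHS](eq_bigr (fun i => P (B `&` h @^-1` [set i]))); last first.
  by move=> i _; rewrite prE//; exact: measurableI.
rewrite fsbig_seq ?index_enum_uniq//.
rewrite -measure_fin_bigcup//=.
- rewrite -setI_bigcupr; congr (P _); apply/esym/setIidPl => w _.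
  by exists (h w); rewrite //= mem_index_enum.
- by move=> i j _ _ [w [[_ <-] [_ <-]]].
- by move=> i _; exact: measurableI.
Qed.

End real_probability.

Section finite_valued.
Context {d : measure_display} {Omega : measurableType d} {R : realType}.

Lemma measurable_fin_comp (I : finType) (h : Omega -> I) (phi : I -> \bar R) :
  (forall i, measurable (h @^-1` [set i])) ->
  measurable_fun setT (fun w => phi (h w)).
Proof.
move=> mh _ B mB; rewrite setTI.
exact: (@measurable_fin_preimage _ _ I h (phi @^-1` B)).
Qed.

(** The integral over B of a function which factors through the finite-valued h. *)
Lemma integral_fin_valued (P : probability Omega R) (I : finType)
    (h : Omega -> I) (phi : I -> R) B :
  (forall i, measurable (h @^-1` [set i])) -> (forall i, 0 <= phi i) ->
  measurable B ->
  (\int[P]_(w in B) (phi (h w))%:E = (\sum_i phi i * pr P (B `&` h @^-1` [set i]))%:E)%E.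
Proof.
move=> mh phi0 mB.
have mF i : measurable (B `&` h @^-1` [set i]) by exact: measurableI.
have tF : trivIset [set` index_enum I] (fun i => B `&` h @^-1` [set i]).
  by move=> i j _ _ [w [[_ <-] [_ <-]]].
have BE : \big[setU/set0]_i (B `&` h @^-1` [set i]) = B.
  rewrite -[LHS]big_distrr/= -[RHS]setIT; congr (_ `&` _).
  apply/seteqP; split => // w _.
  by rewrite (bigD1 (h w))//=; left.
rewrite -[in LHS]BE ge0_integral_bigsetU ?index_enum_uniq//; first last.
- by move=> w _; rewrite lee_fin.
- apply: (measurable_funS measurableT) => //.
  exact: (measurable_fin_comp (fun i => (phi i)%:E) mh).
rewrite -sumEFin; apply: eq_bigr => i _.
rewrite (eq_integral (cst (phi i)%:E)); last by move=> w; rewrite inE => -[_ /= ->].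
by rewrite integral_cst// EFinM -prE.
Qed.

End finite_valued.

(** Two functions measurable for a sub-sigma-algebra, with equal integrals over its
    elements, are almost surely equal.  The integrals are transported to the
    image of P by the identity, seen as a map to the coarser measurable space. *)
Lemma ae_eq_sub_sigma {d} {Omega : measurableType d} {R : realType}
    (P : probability Omega R) (F : set (set Omega))
    (f g : g_sigma_algebraType F -> \bar R) :
  <<s F >> `<=` measurable ->
  measurable_fun setT f -> measurable_fun setT g ->
  (forall w, 0 <= f w <= 1)%E -> (forall w, 0 <= g w)%E ->
  (forall B, <<s F >> B -> \int[P]_(w in B) f w = \int[P]_(w in B) g w)%E ->
  {ae P, forall w, f w = g w}.
Proof.
move=> Fm mf mg f01 g0 fg.
pose phi : Omega -> g_sigma_algebraType F := id.
have mphi : measurable_fun setT phi by move=> _ B mB; rewrite setTI; exact: Fm.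
pose mphi_mixin := isMeasurableFun.Build _ _ _ _ _ mphi.
pose phi_mfun : {mfun Omega >-> g_sigma_algebraType F} := HB.pack phi mphi_mixin.
pose mu : probability (g_sigma_algebraType F) R := distribution P phi_mfun.
have muE B h : <<s F >> B -> (forall w, 0 <= h w)%E ->
    measurable_fun setT h -> (\int[mu]_(w in B) h w = \int[P]_(w in B) h w)%E.
  move=> FB h0 mh; rewrite ge0_integral_pushforward//.
  exact: (measurable_funS measurableT).
have mufi : mu.-integrable setT f.
  apply/integrableP; split => //.
  have f0 w : (0 <= f w)%E by case/andP: (f01 w).
  rewrite (eq_integral f); last by move=> w _; rewrite gee0_abs.
  apply: (@le_lt_trans _ _ (\int[mu]_(w in setT) cst 1 w)%E).
    by apply: ge0_le_integral => // w _; case/andP: (f01 w).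
  have muT : mu setT = 1%E := probability_setT mu.
  by rewrite integral_cst// mul1e [X in (X < _)%E]muT ltry.
have : ae_eq mu setT f g.
  apply: integral_ae_eq => // B _ FB.
  by rewrite !muE// ?fg// => w; case/andP: (f01 w).
move=> [B [FB muB sub]]; exists B; split => //; first exact: Fm.
by move=> w /= fgw; apply: sub => /= h; apply: fgw; exact: h.
Qed.

(** * Cylinder events *)

Section cylinders.
Context {d d' : measure_display} {Omega : measurableType d} {R : realType}.
Context {P : probability Omega R} {T : measurableType d'} {I : choiceType}.
Variable Y : I -> {RV P >-> T}.

(** Events constraining finitely many variables, each one separately. *)
Definition cylinder (J : {fset I}) (C : I -> set T) : set Omega :=
  \bigcap_(i in [set` J]) Y i @^-1` C i.

(** The cylinders on indices in D; they form a pi-system generating sigma(Y i : i in D). *)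
Definition cylinders (D : set I) : set (set Omega) :=
  [set B | exists J C, [/\ forall i, measurable (C i), [set` J] `<=` D &
    B = cylinder J C]].

Lemma measurable_rv_preimage i (C : set T) :
  measurable C -> measurable (Y i @^-1` C).
Proof. by move=> mC; rewrite -[X in measurable X]setTI; exact: measurable_funPT. Qed.

Lemma measurable_cylinder J C : (forall i, measurable (C i)) ->
  measurable (cylinder J C).
Proof.
move=> mC; apply: fin_bigcap_measurable => // i _; exact: measurable_rv_preimage.
Qed.

Lemma cylinders_setI D : setI_closed (cylinders D).
Proof.
move=> _ _ [J [C [mC JD ->]]] [J' [C' [mC' JD' ->]]].
(* Outside its own index set each cylinder imposes no constraint. *)
pose ext K (F : I -> set T) i := if i \in (K : {fset I}) then F i else setT.
exists (J `|` J')%fset, (fun i => ext J C i `&` ext J' C' i); split.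
- by move=> i; apply: measurableI; rewrite /ext; case: ifP.
- by move=> i /=; rewrite in_fsetU => /orP[/JD|/JD'].
- apply/seteqP; split => [w [Jw J'w] i /= _|w H].
    rewrite /ext; split; case: ifP => // iJ; [exact: Jw|exact: J'w].
  split=> i /= iJ; have /= := H i; rewrite in_fsetU iJ ?orbT => /(_ isT)[];
    by rewrite /ext iJ.
Qed.

Lemma sigma_family_cylinders D :
  <<s family_preimages D (fun i => Y i : Omega -> T) >> `<=` <<s cylinders D >>.
Proof.
apply: sub_sigma_algebra2 => _ [i Di [C mC <-]].
exists [fset i]%fset, (fun=> C); split => //.
- by move=> j /=; rewrite inE => /eqP ->.
- rewrite setTI; apply/seteqP; split => [w Cw j /=|w]; first by rewrite inE => /eqP ->.
  by apply; rewrite /= inE.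
Qed.

Lemma measurable_sigma_family D B :
  <<s family_preimages D (fun i => Y i : Omega -> T) >> B -> measurable B.
Proof.
apply: smallest_sub; first exact: sigma_algebra_measurable.
by move=> _ [i _ [C mC <-]]; rewrite setTI; exact: measurable_rv_preimage.
Qed.

Lemma sigma_family_le D D' : D `<=` D' ->
  <<s family_preimages D (fun i => Y i : Omega -> T) >> `<=`
  <<s family_preimages D' (fun i => Y i : Omega -> T) >>.
Proof.
move=> DD'; apply: sub_sigma_algebra2 => _ [i Di [C mC <-]].
by exists i; [exact: DD'|exists C].
Qed.

Lemma sigma_family_preimage D i (C : set T) : D i -> measurable C ->
  <<s family_preimages D (fun i => Y i : Omega -> T) >> (Y i @^-1` C).
Proof.
move=> Di mC; apply: sub_sigma_algebra; exists i => //; exists C => //.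
by rewrite setTI.
Qed.

(** An identity P(B & A1) = c P(B & A2) extends from cylinders to the sigma-algebra
    they generate, as both sides are finite measures in B.  With A2 = setT and
    c = P(A1), this is the independence of A1 from the sigma-algebra. *)
Lemma sigma_family_proportional D (c : R) A1 A2 :
  0 <= c -> measurable A1 -> measurable A2 ->
  (forall B, cylinders D B -> pr P (B `&` A1) = c * pr P (B `&` A2)) ->
  forall B, <<s family_preimages D (fun i => Y i : Omega -> T) >> B ->
  pr P (B `&` A1) = c * pr P (B `&` A2).
Proof.
move=> c0 mA1 mA2 cylE B sB; have mB := measurable_sigma_family sB.
apply: EFin_inj; rewrite EFinM -!prE; [|exact: measurableI..].
pose r : {nonneg R} := NngNum c0.
have Gm : cylinders D `<=` measurable.
  by move=> _ [J [C [mC _ ->]]]; exact: measurable_cylinder.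
apply: (@g_sigma_algebra_measure_unique _ _ _ (cylinders D) Gm (fun=> setT) _ _
  (mrestr P mA1) (mscale r (mrestr P mA2))).
- move=> _; exists fset0, (fun=> setT); split => //.
  by apply/seteqP; split => // w _ i.
- by rewrite bigcup_const//; exists 0%N.
- exact: cylinders_setI.
- move=> A cA; have mA := Gm _ cA.
  rewrite /= /mscale/= /mrestr !prE; [|exact: measurableI..].
  by rewrite -EFinM cylE.
- move=> _; by rewrite /= /mrestr setTI prE// ltry.
- exact: sigma_family_cylinders.
Qed.

End cylinders.

(** * Uniform laws *)

Section uniform_weight.
Variables (R : realType) (E : finType).

(** The mass given to A by the uniform law on S, as a real number; it is 0 when S is
    empty. *)
Definition weight (S : {set E}) (A : set E) : R := fine (@uniform_law R E [set` S] A).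

Lemma weightE S A : weight S A = #|[pred x in S | x \in A]|%:R / #|S|%:R.
Proof.
rewrite /weight /uniform_law /=; congr (_%:R / _%:R); apply: eq_card => x.
  by rewrite !inE; apply/asboolP/andP => [[? ?]|[? /asboolP ?]]; split => //; apply/asboolP.
exact: asboolb.
Qed.

Lemma weight_ge0 S A : 0 <= weight S A.
Proof. by rewrite weightE divr_ge0. Qed.

Lemma weight_le1 S A : weight S A <= 1.
Proof.
rewrite weightE; have [->|S0] := eqVneq (#|S|%:R : R) 0; first by rewrite invr0 mulr0.
have S_gt0 : 0 < #|S|%:R :> R by rewrite lt_def S0 ler0n.
rewrite ler_pdivrMr// mul1r ler_nat subset_leq_card//.
by apply/fintype.subsetP => x; rewrite inE => /andP[].
Qed.

End uniform_weight.

Section uniform_measure.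
Context {dE : measure_display} {E : finDiscreteMeasurableType dE} {R : realType}.

(** The uniform law on S as a measure, the sum of its point masses (the zero measure
    if S is empty).  Points are listed by enum E, and the default value of nth is
    never used. *)
Definition uniform_measure (S : {set E}) : {measure set E -> \bar R} :=
  msum (fun k => mscale (NngNum (weight_ge0 R S [set nth point (enum E) k]))
    (\d_(nth point (enum E) k))) #|E|.

Lemma uniform_measureE S A : uniform_measure S A = uniform_law [set` S] A.
Proof.
transitivity ((weight R S A)%:E) => //.
rewrite /uniform_measure /= /msum /= /mscale /=.
pose F x := weight R S [set x] * (x \in A)%:R.
transitivity (\sum_(k < size (enum E)) (F (nth point (enum E) k))%:E)%E.
  rewrite -cardE; apply: eq_bigr => k _; by rewrite EFinM /dirac indicE.
rewrite -(big_mkord xpredT (fun k => (F (nth point (enum E) k))%:E)).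
rewrite -(big_nth _ xpredT (fun x => (F x)%:E)).
rewrite big_enum sumEFin; congr EFin; rewrite /F weightE.
under eq_bigr do rewrite weightE mulrAC.
rewrite -mulr_suml; congr (_ / _); rewrite -sum1_card natr_sum big_mkcond/=.
rewrite [RHS]big_mkcond/=; apply: eq_bigr => x _; rewrite inE.
have in1 y : (y \in [set x]%classic) = (y == x) by apply/asboolP/eqP.
have -> : #|[pred y in S | y \in [set x]%classic]| = (x \in S) :> nat.
  have [xS|xS] /= := boolP (x \in S).
    apply: (@fintype.eq_card1 _ x) => y; rewrite !inE in1 andb_idl// => /eqP ->.
    exact: xS.
  apply: fintype.eq_card0 => y; rewrite !inE in1.
  by apply/negP => /andP[yS /eqP yx]; move: xS; rewrite -yx yS.
by case: (x \in S); case: (x \in A); rewrite ?mulr1 ?mulr0.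
Qed.

End uniform_measure.

(** * Innovations and the limit image *)

Lemma fset_int_bounded (J : {fset int}) :
  exists N : nat, forall i : int, i \in J -> (`|i| <= N)%N.
Proof.
exists (\max_(i <- J) `|i|)%N => i iJ.
exact: (@leq_bigmax_seq int (J : seq int) xpredT (fun i => `|i|%N)).
Qed.

Section innovations.
Context {R : realType} {d dE dG : measure_display}.
Context {Omega : measurableType d} {P : probability Omega R}.
Context {E : finDiscreteMeasurableType dE} {G : measurableType dG}.
Variables (f : {mfun (E * G)%type >-> E}) (beta : probability G R).
Variable V : int -> {RV P >-> G}.
Hypothesis V_iid : iid beta V.

(** The events determined by the innovations of index > a. *)
Definition sigma_after (a : int) : set (set Omega) :=
  <<s family_preimages [set k : int | a < k] (fun n => V n : Omega -> G) >>.

Lemma pr_innovation n (C : set G) : measurable C ->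
  pr P (V n @^-1` C) = pr beta C.
Proof. by move=> mC; rewrite /pr -(V_iid.2 n). Qed.

(** Here the future of a consists of the indices > a. *)
Lemma innovation_indep_future a (C : set G) : measurable C ->
  forall B, sigma_after a B ->
  pr P (B `&` V a @^-1` C) = pr beta C * pr P B.
Proof.
move=> mC B sB; rewrite -[in RHS](setIT B).
apply: (sigma_family_proportional (pr_ge0 _ _) _ _ _ sB) => //.
  exact: measurable_rv_preimage.
move=> {sB}B [J [F [mF Ja ->]]]; rewrite setIT.
pose F' i := if i == a then C else F i.
have aJ : a \notin J by apply/negP => /Ja /=; rewrite ltxx.
have FF' : {in J, F' =1 F}.
  by move=> i iJ; rewrite /F'; case: eqP => // ia; rewrite -ia iJ in aJ.
have -> : cylinder V J F `&` V a @^-1` C = cylinder V (a |` J)%fset F'.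
  apply/seteqP; split => [w [Jw aw] i /=|w H].
    rewrite in_fset1U => /orP[/eqP ->|iJ]; first by rewrite /F' eqxx.
    by rewrite FF'//; exact: Jw.
  split; last by have := H a; rewrite /F' eqxx /=; apply; rewrite in_fset1U eqxx.
  move=> i /= iJ; have := H i; rewrite /= FF'//; apply.
  by rewrite in_fset1U [i \in J]iJ orbT.
have mF' i : measurable (F' i) by rewrite /F'; case: ifP.
have mP i : measurable (V i @^-1` F' i) by exact: measurable_rv_preimage.
have mP' i : measurable (V i @^-1` F i) by exact: measurable_rv_preimage.
rewrite /pr (V_iid.1 _ _ mF') (V_iid.1 _ _ mF).
rewrite (eq_bigr (fun i => (pr P (V i @^-1` F' i))%:E)); last by move=> i _; rewrite prE.
rewrite [X in _ = _ * fine X](eq_bigr (fun i => (pr P (V i @^-1` F i))%:E)); last first.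
  by move=> i _; rewrite prE.
rewrite !prodEFin /= big_fsetU1//= {1}/F' eqxx pr_innovation//; congr (_ * _).
by apply: eq_big_seq => i iJ; rewrite FF'.
Qed.

(** The self-map x |-> f (x, v). *)
Definition innov_map (v : G) : {ffun E -> E} := [ffun x => f (x, v)].

(** The law of the self-map given by one innovation. *)
Definition innov_law (g : {ffun E -> E}) : R := pr beta (innov_map @^-1` [set g]).

Lemma measurable_innov x (A : set E) : measurable [set v | A (f (x, v))].
Proof.
rewrite -[X in measurable X]setTI.
by have := measurable_fun_pair2 x (measurable_funPT f) measurableT (discrete_measurableP A).
Qed.

Lemma measurable_innov_map g : measurable (innov_map @^-1` [set g]).
Proof.
rewrite (_ : _ @^-1` _ = \bigcap_(x in [set: E]) [set v | f (x, v) = g x]).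
  by apply: fin_bigcap_measurable => // x _; exact: (measurable_innov x [set g x]).
apply/seteqP; split => [v /= <- x _ /=|v H]; first by rewrite ffunE.
by apply/ffunP => x; rewrite ffunE; exact: H.
Qed.

Lemma innov_law_ge0 g : 0 <= innov_law g.
Proof. exact: pr_ge0. Qed.

Lemma innov_law_sum1 : \sum_g innov_law g = 1.
Proof.
rewrite -(pr_setT beta) (pr_partition beta measurable_innov_map measurableT).
by apply: eq_bigr => g _; rewrite setTI.
Qed.

Lemma innov_kernelE x y : pr beta [set v | f (x, v) = y] = map_kernel innov_law x y.
Proof.
rewrite (pr_partition beta measurable_innov_map); last exact: (measurable_innov x [set y]).
apply: eq_bigr => g _; rewrite /innov_law; have [gxy|gxy] := eqVneq (g x) y.
  rewrite mulr1; congr (pr beta _); apply/seteqP; split => [v []//|v /= vg].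
  by split => //; rewrite -gxy -vg ffunE.
rewrite mulr0 (_ : _ `&` _ = set0) ?pr_set0//.
apply/seteqP; split => // v [/= vy vg]; move/eqP: gxy; apply.
by rewrite -vg ffunE.
Qed.

Lemma transitionE : transition f V = map_kernel innov_law.
Proof.
apply/funext => x; apply/funext => y; rewrite -innov_kernelE.
rewrite -(pr_innovation 1); last exact: (measurable_innov x [set y]).
by [].
Qed.

(** T_n as a random element of the finite set of self-maps of E. *)
Definition backward (n : nat) (w : Omega) : {ffun E -> E} :=
  [ffun x => backward_map f V n w x].

Lemma backward0 w : backward 0 w = map_id E.
Proof. by apply/ffunP => x; rewrite !ffunE. Qed.

Lemma backwardS n w :
  backward n.+1 w = map_comp (backward n w) (innov_map (V (- n%:Z) w)).
Proof. by apply/ffunP => x; rewrite !ffunE. Qed.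

Lemma sigma_after_backward n T : sigma_after (- n%:Z) (backward n @^-1` [set T]).
Proof.
pose S a := g_sigma_algebraType
  (family_preimages [set k : int | a < k] (fun n => V n : Omega -> G)).
suff: forall a, a <= - n%:Z -> sigma_after a (backward n @^-1` [set T]) by exact.
elim: n T => [|n IH] T a an.
  have [->|TN] := eqVneq T (map_id E).
    rewrite (_ : _ @^-1` _ = setT); first exact: (@measurableT _ (S a)).
    by apply/seteqP; split => // w _; exact: backward0.
  rewrite (_ : _ @^-1` _ = set0); first exact: (@measurable0 _ (S a)).
  apply/seteqP; split => // w /=; rewrite backward0 => /esym; exact/eqP.
rewrite (_ : _ @^-1` _ = \bigcup_(u in [set u : {ffun E -> E} * {ffun E -> E} |
    map_comp u.1 u.2 = T]) (backward n @^-1` [set u.1] `&`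
     V (- n%:Z) @^-1` (innov_map @^-1` [set u.2]))).
  apply: (@fin_bigcup_measurable _ (S a)) => // u _.
  apply: (@measurableI _ (S a)); first by apply: IH; lia.
  by apply: sigma_family_preimage; [rewrite /=; lia|exact: measurable_innov_map].
apply/seteqP; split => [w /= wT|w [u /= uT [/= wu1 wu2]]].
  by exists (backward n w, innov_map (V (- n%:Z) w)) => //=; rewrite -backwardS.
by rewrite backwardS wu1 wu2.
Qed.

Lemma measurable_backward n T : measurable (backward n @^-1` [set T]).
Proof. by apply: (measurable_sigma_family (Y := V)); exact: sigma_after_backward. Qed.

Lemma backward_law n T : pr P (backward n @^-1` [set T]) = comp_law innov_law n T.
Proof.
elim: n T => [|n IH] T.
  rewrite /=; have [->|TN] := eqVneq T (map_id E).
    rewrite (_ : _ @^-1` _ = setT) ?pr_setT//.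
    by apply/seteqP; split => // w _; exact: backward0.
  rewrite (_ : _ @^-1` _ = set0) ?pr_set0//.
  apply/seteqP; split => // w /=; rewrite backward0 => /esym; exact/eqP.
have mV g : measurable ((fun w => innov_map (V (- n%:Z) w)) @^-1` [set g]).
  exact: measurable_rv_preimage (measurable_innov_map g).
rewrite (pr_partition P (measurable_backward n) (measurable_backward n.+1 T)).
rewrite [RHS]/=; apply: eq_bigr => T' _.
rewrite (pr_partition P mV); last by apply: measurableI; exact: measurable_backward.
rewrite mulr_sumr; apply: eq_bigr => g _.
have [TE|TN] := eqVneq (map_comp T' g) T.
  rewrite mulr1 -IH mulrC.
  rewrite -(innovation_indep_future (measurable_innov_map g) (@sigma_after_backward n T')).
  congr (pr P _); apply/seteqP; split => [w [[_ wT'] wg]//|w [/= wT' wg]].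
  by split => //; split => //=; rewrite backwardS wT' wg.
rewrite !mulr0 (_ : _ `&` _ = set0) ?pr_set0//.
apply/seteqP; split => // w [[/= + wT'] wg]; rewrite backwardS wT' wg.
exact/eqP.
Qed.

Let q := innov_law.

(** R_0 as an element of the finite type of subsets of E. *)
Definition limit_set (w : Omega) : {set E} := [set x in limit_image f V w]%SET.

Lemma limit_setE w : limit_image f V w = [set` limit_set w].
Proof. by apply/seteqP; split => x /=; rewrite !inE. Qed.

Lemma limit_setP w x :
  reflect (forall n, x \in backward n w @: E) (x \in limit_set w).
Proof.
rewrite !inE; apply: (iffP idP) => [|H].
  rewrite inE => H n; have [y _ <-] := H n Logic.I.
  by apply/imsetP; exists y => //; rewrite ffunE.
rewrite inE => n _; have /imsetP[y _ ->] := H n.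
by exists y => //; rewrite ffunE.
Qed.

Lemma backward_image_anti n m w : (n <= m)%N ->
  backward m w @: E \subset backward n w @: E.
Proof.
move=> /subnKC <-; elim: (m - n)%N => [|k IH]; first by rewrite addn0.
rewrite addnS backwardS map_comp_image (fintype.subset_trans _ IH)// imsetS//.
exact: subset_predT.
Qed.

(** The images T_n(E) decrease, so a term of least cardinality is their intersection. *)
Lemma limit_set_min_rank n w :
  (forall m, (map_rank (backward n w) <= map_rank (backward m w))%N) ->
  limit_set w = backward n w @: E.
Proof.
move=> nmin; apply/setP => x; apply/limit_setP/idP => [|xn m]; first exact.
have [nm|/ltnW mn] := leqP n m; last first.
  by move/fintype.subsetP: (backward_image_anti w mn); exact.
have /eqP -> // : backward m w @: E == backward n w @: E.
by rewrite eqEcard backward_image_anti//=; exact: nmin.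
Qed.

Lemma limit_set_minimal n w : minimal q (backward n w) ->
  (forall m, reachable q (backward m w)) ->
  limit_set w = backward n w @: E.
Proof. by move=> [_ nmin] reach; apply: limit_set_min_rank => m; exact: nmin. Qed.

Lemma limit_set_neq0 w : limit_set w != finset.set0.
Proof.
have ex : exists k, `[< exists n, map_rank (backward n w) = k >].
  by exists (map_rank (backward 0 w)); apply/asboolP; exists 0%N.
case: (ex_minnP ex) => k /asboolP[n nk] kmin.
rewrite (@limit_set_min_rank n) => [|m].
  by apply/set0Pn; exists (backward n w point); exact: imset_f.
by rewrite nk; apply: kmin; apply/asboolP; exists m.
Qed.

(** The generators of sigma(V): the preimages of measurable sets by the V n. *)
Definition sigma_innov : set (set Omega) :=
  family_preimages [set: int] (fun n => V n : Omega -> G).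

Lemma sigma_innov_limit_set S : <<s sigma_innov >> (limit_set @^-1` [set S]).
Proof.
pose M := g_sigma_algebraType sigma_innov.
have mem n x : (measurable : set (set M)) [set w | x \in backward n w @: E].
  rewrite (_ : [set w | _] = \bigcup_(T in [set T : {ffun E -> E} | x \in T @: E])
      backward n @^-1` [set T]); last first.
    by apply/seteqP; split => [w wx|w [T Tx /= wT]]; [exists (backward n w)|rewrite /= wT].
  apply: (@fin_bigcup_measurable _ M) => // T _.
  have := @sigma_after_backward n T.
  exact: (@sigma_family_le _ _ _ _ _ _ _ V _ setT (fun _ _ => Logic.I)).
have mem' x : (measurable : set (set M)) [set w | x \in limit_set w].
  rewrite (_ : [set w | _] = \bigcap_n [set w | x \in backward n w @: E]).
    exact: (@bigcapT_measurable _ M).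
  apply/seteqP; split => [w /limit_setP H n _|w H]; first exact: H.
  by apply/limit_setP => n; exact: H.
rewrite (_ : _ @^-1` _ = \bigcap_(x in [set: E]) [set w | (x \in limit_set w) = (x \in S)]).
  apply: (@fin_bigcap_measurable _ M) => // x _; case: (x \in S); first exact: mem'.
  rewrite (_ : [set w | _] = ~` [set w | x \in limit_set w]).
    exact: (@measurableC _ M).
  by apply/seteqP; split => [w /= ->//|w /= /negP/negbTE].
apply/seteqP; split => [w /= wS x _ /=|w H]; first by rewrite wS.
by apply/setP => x; exact: H.
Qed.

Lemma measurable_limit_set S : measurable (limit_set @^-1` [set S]).
Proof. by apply: (measurable_sigma_family (Y := V)); exact: sigma_innov_limit_set. Qed.

Lemma reachable_ae : exists B, [/\ measurable B, pr P B = 0 &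
  forall w, (~` B) w -> forall m, reachable q (backward m w)].
Proof.
have N m : P.-negligible (backward m @^-1` [set T | ~ reachable q T]).
  have mN := measurable_fin_preimage [set T | ~ reachable q T]
    (@measurable_backward m).
  suff PN : P (backward m @^-1` [set T | ~ reachable q T]) = 0%E by exact/negligibleP.
  rewrite (prE P mN); congr EFin.
  rewrite (pr_partition P (@measurable_backward m))//.
  apply: big1 => T _; have [rT|rT] := pselect (reachable q T).
    rewrite (_ : _ `&` _ = set0) ?pr_set0//.
    by apply/seteqP; split => // w [/= + wT]; rewrite wT.
  apply/eqP; rewrite eq_le pr_ge0 andbT.
  rewrite (@le_trans _ _ (pr P (backward m @^-1` [set T])))//.
    by apply: pr_le; [apply: measurableI => //|..]; try exact: measurable_backward.
  rewrite backward_law leNgt; apply/negP => h; apply: rT; by exists m.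
have [B [mB PB0 sub]] := negligible_bigcup N.
exists B; split => //; first by rewrite /pr PB0.
move=> w /= nBw m; apply: contrapT => nr; apply: nBw; apply: sub.
by exists m.
Qed.

(** On the event that T_n is a minimal map T, the set R_0 is almost surely T(E). *)
Lemma pr_limit_set_minimal n T S W : minimal q T -> measurable W ->
  pr P (W `&` limit_set @^-1` [set S] `&` backward n @^-1` [set T]) =
  (T @: E == S)%:R * pr P (W `&` backward n @^-1` [set T]).
Proof.
move=> mT mW; have [B [mB PB0 Bsub]] := reachable_ae.
have mS := measurable_limit_set S; have mn := @measurable_backward n T.
have [TS|TS] := eqVneq (T @: E) S.
  rewrite mul1r; apply/le_anti/andP; split.
    apply: pr_le; [by do ?apply: measurableI|exact: measurableI|].
    by move=> w [[Ww _] wT].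
  apply: (le_trans (pr_setD_null _ mB PB0)); first exact: measurableI.
  apply: pr_le; [by apply: measurableD => //; exact: measurableI|by do ?apply: measurableI|].
  move=> w [[Ww /= wT] nB]; split => //; split => //=.
  by rewrite (@limit_set_minimal n) ?wT//; exact: Bsub.
rewrite mul0r; apply/le_anti/andP; split; last exact: pr_ge0.
apply: (le_trans (pr_setD_null _ mB PB0)); first by do ?apply: measurableI.
rewrite (_ : _ `\` _ = set0) ?pr_set0//; apply/seteqP; split => // w [[[_ /= wS] wT] nB].
by move/eqP: TS; apply; rewrite -wS (@limit_set_minimal n) ?wT//; exact: Bsub.
Qed.

End innovations.

(** * The chain and its conditional law *)

Section chain.
Context {R : realType} {d dE dG : measure_display}.
Context {Omega : measurableType d} {P : probability Omega R}.
Context {E : finDiscreteMeasurableType dE} {G : measurableType dG}.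
Variables (f : {mfun (E * G)%type >-> E}) (beta : probability G R).
Variables (V : int -> {RV P >-> G}) (X : int -> {RV P >-> E}).
Hypothesis V_iid : iid beta V.
Hypothesis X_rec : forall (n : int) (w : Omega),
  X (n + 1) w = f (X n w, V (n + 1) w).
Hypothesis V_indep_past : forall n : int,
  independent_of_family P (V (n + 1)) [set k : int | k <= n]
    (fun k w => (X k w, V k w)).

Lemma measurable_state n (A : set E) : measurable (X n @^-1` A).
Proof. exact: measurable_rv_preimage (discrete_measurableP A). Qed.

(** X_a is independent of the later innovations: they are split off one at a time,
    starting from the last one, each being independent of the chain and the
    innovations before it. *)
Lemma pr_state_cylinder (a : int) z (J : {fset int}) (C : int -> set G) :
  (forall i, measurable (C i)) -> (forall i : int, i \in J -> a < i) ->
  pr P (cylinder V J C `&` X a @^-1` [set z]) =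
  pr P (X a @^-1` [set z]) * pr P (cylinder V J C).
Proof.
move=> mC Ja.
have mVC i : measurable (V i @^-1` C i) by exact: measurable_rv_preimage.
have -> : pr P (cylinder V J C) = \prod_(i <- J) pr P (V i @^-1` C i).
  rewrite /pr (V_iid.1 _ _ mC).
  by rewrite (eq_bigr (fun i => (pr P (V i @^-1` C i))%:E)) ?prodEFin// => i _; rewrite prE.
have [N JN] : exists N : nat, forall i : int, i \in J -> i <= a + N%:Z.
  have [M JM] := fset_int_bounded J.
  by exists (M + `|a|)%N => i iJ; have := JM _ iJ; lia.
elim: N J Ja JN => [|N IH] J Ja JN.
  have -> : J = fset0.
    apply/fsetP => i; rewrite inE; apply/negbTE/negP => iJ.
    by have := Ja _ iJ; have := JN _ iJ; lia.
  rewrite big_seq_fset0 mulr1; congr (pr P _); apply/seteqP.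
  by split => [w []//|w wz]; split.
set j := a + N%:Z + 1.
have [jJ|jJ] := boolP (j \in J); last first.
  apply: IH => // i iJ; have := JN _ iJ => iN; have : i != j by apply: contraNneq jJ => <-.
  by rewrite /j in jJ *; lia.
set J' := (J `\ j)%fset.
have J'J i : i \in J' -> i \in J by rewrite in_fsetD1 => /andP[].
have J'N i : i \in J' -> i <= a + N%:Z.
  rewrite in_fsetD1 => /andP[ij /JN]; rewrite /j in ij; lia.
have cylE : cylinder V J C = V j @^-1` C j `&` cylinder V J' C.
  apply/seteqP; split => [w H|w [jw H] i /= iJ].
    by split => [|i /J'J iJ]; exact: H.
  by have [->//|ij] := eqVneq i j; apply: H; rewrite /= in_fsetD1 ij.
rewrite cylE -setIA.
pose past := family_preimages [set k : int | k <= a + N%:Z] (fun k w => (X k w, V k w)).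
have sB : <<s past >> (cylinder V J' C `&` X a @^-1` [set z]).
  apply: (@measurableI _ (g_sigma_algebraType past)).
    apply: (@fin_bigcap_measurable _ (g_sigma_algebraType past)) => // i iJ'.
    apply: sub_sigma_algebra; exists i; first exact: J'N.
    exists (setT `*` C i); first exact: measurableX.
    by rewrite setTI; apply/seteqP; split => [w []|w].
  apply: sub_sigma_algebra; exists a; first by rewrite /=; lia.
  exists ([set z] `*` setT); first by apply: measurableX => //; exact: discrete_measurableP.
  by rewrite setTI; apply/seteqP; split => [w []|w].
rewrite [LHS]/pr V_indep_past// fineM ?fin_num_measure//; first last.
- apply: measurableI; last exact: measurable_state.
  exact: measurable_cylinder.
rewrite -/(pr P _) -/(pr P _) IH//; last by move=> i /J'J; exact: Ja.
by rewrite [in RHS](big_fsetD1 j)//= mulrCA.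
Qed.

Lemma state_indep_future a z B : sigma_after V a B ->
  pr P (B `&` X a @^-1` [set z]) = pr P (X a @^-1` [set z]) * pr P B.
Proof.
move=> sB; rewrite -[in RHS](setIT B).
apply: (sigma_family_proportional (pr_ge0 _ _) _ _ _ sB) => //.
  exact: measurable_state.
move=> {sB}B [J [F [mF Ja ->]]]; rewrite setIT; exact: pr_state_cylinder.
Qed.

Lemma state_law_step n y : pr P (X (n + 1) @^-1` [set y]) =
  \sum_x pr P (X n @^-1` [set x]) * map_kernel (innov_law f beta) x y.
Proof.
rewrite (pr_partition P (fun x => measurable_state n [set x])); last exact: measurable_state.
apply: eq_bigr => x _.
have mxy := measurable_innov f x [set y].
rewrite -innov_kernelE -(pr_innovation V_iid (n + 1) mxy) -state_indep_future; last first.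
  by apply: sigma_family_preimage => //=; lia.
congr (pr P _); apply/seteqP; split => w /= [+ wx]; rewrite X_rec wx//.
Qed.

Hypothesis Pi_irreducible : irreducible_kernel (transition f V).
Hypothesis Pi_aperiodic : aperiodic_kernel (transition f V).

Let q := innov_law f beta.
Let q_ge0 : forall g, 0 <= q g := innov_law_ge0 f beta.
Let q_sum1 : \sum_g q g = 1 := innov_law_sum1 f beta.

Let irr : irreducible_kernel (map_kernel q).
Proof. by rewrite -(transitionE f V_iid). Qed.

(** The common law of the X_n, see state_law_stationary. *)
Definition state_law (x : E) : R := pr P (X 0 @^-1` [set x]).

Lemma state_law_sum1 : \sum_x state_law x = 1.
Proof.
rewrite -(pr_setT P) (pr_partition P (fun x => measurable_state 0 [set x]) measurableT).
by apply: eq_bigr => x _; rewrite setTI.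
Qed.

Lemma state_law_stationary n x : pr P (X n @^-1` [set x]) = state_law x.
Proof.
have sum1 a : \sum_x pr P (X a @^-1` [set x]) = 1.
  rewrite -(pr_setT P) (pr_partition P (fun x => measurable_state a [set x]) measurableT).
  by apply: eq_bigr => y _; rewrite setTI.
have step (a : int) (k : nat) y : pr P (X (a - k%:Z) @^-1` [set y]) =
    \sum_x pr P (X (a - k.+1%:Z) @^-1` [set x]) * map_kernel q x y.
  by rewrite -state_law_step (_ : a - k.+1%:Z + 1 = a - k%:Z)//; lia.
have aper : aperiodic_kernel (map_kernel q) by rewrite -(transitionE f V_iid).
have := backward_orbit_unique (map_kernel_ge0 q_ge0) (map_kernel_sum1 q_sum1)
  irr aper (step n) (step 0) (fun k x => pr_ge0 _ _) (fun k => sum1 _)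
  (fun k x => pr_ge0 _ _) (fun k => sum1 _).
by move=> /(_ x); rewrite !subr0.
Qed.

Lemma state_lawE y : state_law y = \sum_x state_law x * map_kernel q x y.
Proof.
rewrite -(state_law_stationary (0 + 1)) state_law_step; apply: eq_bigr => x _.
by rewrite state_law_stationary.
Qed.

Lemma state_backward n w : X 0 w = backward f V n w (X (- n%:Z) w).
Proof.
elim: n => [|n IH]; first by rewrite ffunE.
rewrite IH !ffunE /=; congr (backward_map _ _ _ _ _).
rewrite (_ : - n%:Z = - n.+1%:Z + 1); last by lia.
exact: X_rec.
Qed.

(** On an event contained in T_n = T, X_0 is T(X_(-n)) with X_(-n) independent of the
    event. *)
Lemma pr_state_backward n T (A : set E) B : sigma_after V (- n%:Z) B ->
  B `<=` backward f V n @^-1` [set T] ->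
  pr P (B `&` X 0 @^-1` A) = (\sum_(z | T z \in A) state_law z) * pr P B.
Proof.
move=> sB BT.
have mB : measurable B.
  by move: sB; exact: (measurable_sigma_family (Y := V)).
rewrite (pr_partition P (fun x => measurable_state (- n%:Z) [set x])); last first.
  by apply: measurableI => //; exact: measurable_state.
rewrite mulr_suml [RHS]big_mkcond; apply: eq_bigr => z _; case: ifPn => zA.
  rewrite -(state_law_stationary (- n%:Z)) -state_indep_future//.
  congr (pr P _); apply/seteqP; split => [w [[]]//|w [Bw wz]].
  split=> //; split=> //=; rewrite (state_backward n) (BT _ Bw) wz.
  by rewrite inE in zA.
rewrite (_ : _ `&` _ = set0) ?pr_set0//.
apply/seteqP; split => // w [[Bw /=]]; rewrite (state_backward n) (BT _ Bw) => + wz.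
by rewrite wz; move/negP: zA; rewrite inE.
Qed.

Lemma minimal_weight T A : minimal q T ->
  \sum_(z | T z \in A) state_law z = weight R (T @: E) A.
Proof.
move=> mT; rewrite weightE.
rewrite (partition_big T (mem [pred x in T @: E | x \in A]))/=; last first.
  by move=> z zA; rewrite inE zA imset_f.
rewrite (eq_bigr (fun=> (map_rank T)%:R^-1)).
  by rewrite sumr_const mulr_natl.
move=> x /andP[xT xA].
rewrite -(minimal_fiber_mass q_ge0 q_sum1 state_law_sum1 state_lawE irr mT xT).
apply: eq_bigl => z; apply/andP/idP => [[]//|/eqP Tz]; by rewrite Tz.
Qed.

(** Given sigma(V), on the event R_0 = S, the state X_0 is in A with probability
    #|S & A| / #|S|. *)
Lemma limit_set_conditional_law S (A : set E) B : <<s sigma_innov V >> B ->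
  pr P (B `&` (X 0 @^-1` A `&` limit_set f V @^-1` [set S])) =
  weight R S A * pr P (B `&` limit_set f V @^-1` [set S]).
Proof.
have mS := measurable_limit_set f V S; have mA := measurable_state 0 A.
move: B; apply: (sigma_family_proportional (Y := V)); [exact: weight_ge0|exact: measurableI|by []|].
move=> _ [J [C [mC _ ->]]]; set B := cylinder V J C.
have mB : measurable B by exact: measurable_cylinder.
(* A cylinder only involves indices > -n when n is large. *)
have [n0 sB] : exists n0 : nat, forall n : nat, (n0 <= n)%N -> sigma_after V (- n%:Z) B.
  have [M JM] := fset_int_bounded J.
  exists M.+1 => n Mn.
  apply: (@fin_bigcap_measurable _ (g_sigma_algebraType (family_preimages
    [set k : int | - n%:Z < k] (fun n => V n : Omega -> G)))) => // i iJ.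
  apply: sigma_family_preimage => //=; have := JM _ iJ; lia.
have mback n := @measurable_backward _ _ _ _ _ P _ _ f V n.
(* The two sides differ by at most the probability that T_n is not minimal,
   for arbitrarily large n. *)
have [c [m [c01 decay]]] := nonminimal_decay q_ge0 q_sum1.
suff gap j : `|pr P (B `&` (X 0 @^-1` A `&` limit_set f V @^-1` [set S])) -
  weight R S A * pr P (B `&` limit_set f V @^-1` [set S])| <= 1 * c ^+ j.
  by apply/eqP; rewrite -subr_eq0 -normr_le0; exact: geometric_le0 c01 gap.
rewrite mul1r (le_trans _ (decay n0 j))//; set n := (n0 + j * m)%N.
have mBS : measurable (B `&` limit_set f V @^-1` [set S]) by exact: measurableI.
have mBAS : measurable (B `&` (X 0 @^-1` A `&` limit_set f V @^-1` [set S])).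
  by do ?apply: measurableI.
rewrite (pr_partition P (mback n) mBAS) (pr_partition P (mback n) mBS).
rewrite mulr_sumr -sumrB (le_trans (ler_norm_sum _ _ _))//.
(* The terms of the minimal maps cancel. *)
rewrite (bigID (fun T => `[< minimal q T >]))/= big1 ?add0r; last first.
  move=> T /asboolP mT; rewrite setIA.
  rewrite !(pr_limit_set_minimal V_iid _ _ mT)//; last exact: measurableI.
  have [TS|_] := eqVneq (T @: E) S; last by rewrite !mul0r mulr0 subrr normr0.
  rewrite !mul1r setIAC (@pr_state_backward n T).
  - by rewrite (minimal_weight _ mT) TS subrr normr0.
  - apply: (@measurableI _ (g_sigma_algebraType (family_preimages
      [set k : int | - n%:Z < k] (fun n => V n : Omega -> G)))).
      by apply: sB; exact: leq_addr.
    exact: sigma_after_backward.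
  - by move=> w [].
apply: ler_sum => T _; rewrite -(backward_law f V_iid).
set x := pr P _; set y := pr P _.
have x01 : 0 <= x <= pr P (backward f V n @^-1` [set T]).
  by rewrite pr_ge0 pr_le//; exact: measurableI.
have y01 : 0 <= y <= pr P (backward f V n @^-1` [set T]).
  by rewrite pr_ge0 pr_le//; exact: measurableI.
have := weight_ge0 R S A; have := weight_le1 R S A.
rewrite ler_norml; nra.
Qed.

End chain.

(** * The uniform law on the limit image, as a kernel *)

Section limit_kernel.
Context {R : realType} {d dE dG : measure_display}.
Context {Omega : measurableType d} {P : probability Omega R}.
Context {E : finDiscreteMeasurableType dE} {G : measurableType dG}.
Variables (f : {mfun (E * G)%type >-> E}) (V : int -> {RV P >-> G}).

(** The kernel w |-> uniform law on R_0(w), measurable for sigma(V). *)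
Definition limit_kernel (w : g_sigma_algebraType (sigma_innov V)) :
  {measure set E -> \bar R} := uniform_measure (limit_set f V w).

Let limit_kernel_measurable U : measurable U ->
  measurable_fun setT (limit_kernel ^~ U).
Proof.
move=> _; apply: (measurable_fin_comp (fun S => uniform_measure S U)) => S.
exact: sigma_innov_limit_set.
Qed.

HB.instance Definition _ := isKernel.Build _ _ _ _ _ limit_kernel limit_kernel_measurable.

Let limit_kernel_prob w : limit_kernel w [set: E] = 1%E.
Proof.
rewrite /limit_kernel uniform_measureE /uniform_law setIT divff//.
have /set0Pn[x xS] := limit_set_neq0 f V w.
by rewrite pnatr_eq0 -lt0n; apply/card_gt0P; exists x; exact/asboolP.
Qed.

HB.instance Definition _ :=
  Kernel_isProbability.Build _ _ _ _ _ limit_kernel limit_kernel_prob.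

Lemma limit_kernelE w A : limit_kernel w A = uniform_law (limit_image f V w) A.
Proof. by rewrite /limit_kernel uniform_measureE -limit_setE. Qed.

End limit_kernel.

Theorem theorem11 (R : realType) (d dE dG : measure_display)
    (Omega : measurableType d) (P : probability Omega R)
    (E : finDiscreteMeasurableType dE) (G : measurableType dG)
    (f : {mfun (E * G)%type >-> E}) (beta : probability G R)
    (V : int -> {RV P >-> G}) (X : int -> {RV P >-> E})
    (V_iid : iid beta V)
    (X_rec : forall (n : int) (w : Omega),
       X (n + 1) w = f (X n w, V (n + 1) w))
    (V_indep_past : forall n : int,
       independent_of_family P (V (n + 1)) [set k : int | k <= n]
         (fun k w => (X k w, V k w)))
    (Pi_irreducible : irreducible_kernel (transition f V))
    (Pi_aperiodic : aperiodic_kernel (transition f V)) :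
  let sigmaV := family_preimages [set: int] (fun n => V n) in
  (exists mu : R.-pker (g_sigma_algebraType sigmaV) ~> E,
     is_conditional_law (X 0) mu) /\
  (forall mu : R.-pker (g_sigma_algebraType sigmaV) ~> E,
     is_conditional_law (X 0) mu ->
     {ae P, forall w : Omega, forall A : set E,
        mu w A = uniform_law (limit_image f V w) A}).
Proof.
move=> sigmaV.
have limitP : @is_conditional_law _ _ _ _ _ _ (X 0) sigmaV (limit_kernel f (V := V)).
  move=> A B mA sB.
  have mB : measurable B by move: sB; exact: (measurable_sigma_family (Y := V)).
  under eq_integral do rewrite limit_kernelE limit_setE.
  rewrite (integral_fin_valued (phi := fun S => weight R S A) P
    (measurable_limit_set f V) (fun S => weight_ge0 R S A) mB).
  rewrite prE; last by apply: measurableI => //; exact: measurable_state.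
  congr EFin; rewrite (pr_partition P (measurable_limit_set f V)); last first.
    by apply: measurableI => //; exact: measurable_state.
  apply: eq_bigr => S _; rewrite -setIA.
  by rewrite (limit_set_conditional_law V_iid X_rec V_indep_past).
split; first by exists (limit_kernel f (V := V)).
move=> mu muP.
have ae_A (A : set E) : {ae P, forall w, mu w A = limit_kernel f (V := V) w A}.
  apply: ae_eq_sub_sigma.
  - exact: (measurable_sigma_family (Y := V)).
  - exact: measurable_kernel (discrete_measurableP A).
  - exact: measurable_kernel (discrete_measurableP A).
  - move=> w; rewrite measure_ge0/= -(prob_kernel (s := mu) w).
    by apply: le_measure; rewrite ?inE//; exact: discrete_measurableP.
  - by move=> w.
  - by move=> B sB; rewrite muP ?limitP//; exact: discrete_measurableP.
(* A single null event serves for all A, as E has finitely many subsets. *)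
have := filter_forall _ (fun S : {set E} => ae_A [set` S]).
move=> [N [mN PN sub]]; exists N; split => // w /= notE; apply: sub => /= muE.
apply: notE => A; rewrite -limit_kernelE.
have -> : A = [set` [set x in A]%SET].
  by apply/seteqP; split => y /=; rewrite !inE.
exact: muE.
Qed.
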